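(* For every positive integer $n\neq 2$ and every integer $d\geq 2$, $\chi^d_i(K_n)=n-1$.
   Context: All graphs are simple. For a graph $G$, an incidence is a pair $(v,e)$ with $v\in V(G)$ an endpoint of the edge $e\in E(G)$; $I(G)$ is the set of all incidences. For $u\in V(G)$ and a neighbor $v$ of $u$, $(u,uv)$ is a strong incidence of $u$ and $(v,uv)$ is a weak incidence of $u$; $I_u$ and $A_u$ denote the sets of strong and weak incidences of $u$. For a map $\varphi$ on $I(G)$, $\varphi(I_u)=\{\varphi(u,uv): v\in N_G(u)\}$. Let $[k]=\{1,\dots,k\}$. A $d$-defective incidence $k$-coloring of $G$ is a map $\varphi: I(G)\to[k]$ such that for every $u\in V(G)$: (a) $\varphi(u,uv)\neq\varphi(u,uw)$ for distinct $v,w\in N_G(u)$; (b) $\varphi(u,uv)\neq\varphi(v,uv)$ for every $v\in N_G(u)$; (c) every color in $\varphi(I_u)$ appears at most $d$ times among the incidences of $A_u$. $\chi^d_i(G)$ is the minimum $k$ such that $G$ has a $d$-defective incidence $k$-coloring. *)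

(* Defs.v *)
From mathcomp Require Import all_boot.
From mathcomp Require Import boolp.

Set Implicit Arguments.
Unset Strict Implicit.
Unset Printing Implicit Defensive.

Record sgraph := SGraph {
  vertex :> finType;
  adj : rel vertex;
  adj_sym : symmetric adj;
  adj_irrefl : irreflexive adj
}.

Section Incidences.
Variable G : sgraph.
Implicit Types u v : G.

Definition edges : {set {set G}} :=
  [set [set p.1; p.2] | p : G * G & adj p.1 p.2].

Definition incidence : Type :=
  {p : G * {set G} | (p.2 \in edges) && (p.1 \in p.2)}.

Lemma strong_incP u v (uv : adj u v) :
  ([set u; v] \in edges) && (u \in [set u; v]).
Proof.
rewrite set21 andbT; apply/imsetP; by exists (u, v); rewrite ?inE.
Qed.

Lemma weak_incP u v (uv : adj u v) :
  ([set u; v] \in edges) && (v \in [set u; v]).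
Proof. by have /andP[-> _] := strong_incP uv; rewrite set22. Qed.

Definition strong_inc u v (uv : adj u v) : incidence :=
  exist _ (u, [set u; v]) (strong_incP uv).

Definition weak_inc u v (uv : adj u v) : incidence :=
  exist _ (v, [set u; v]) (weak_incP uv).

(* I_u and A_u *)
Definition strong_incs u : {set incidence} :=
  [set i | [exists v, adj u v && (val i == (u, [set u; v]))]].

Definition weak_incs u : {set incidence} :=
  [set i | [exists v, adj u v && (val i == (v, [set u; v]))]].

(* The color set {1, ..., k} is represented by 'I_k. *)
Definition defective_incidence_coloring (d k : nat)
    (phi : incidence -> 'I_k) : Prop :=
  forall u,
  [/\ forall v w (uv : adj u v) (uw : adj u w), v <> w ->
        phi (strong_inc uv) <> phi (strong_inc uw),
      forall v (uv : adj u v), phi (strong_inc uv) <> phi (weak_inc uv)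
    & forall c, c \in phi @: strong_incs u ->
        #|[set i in weak_incs u | phi i == c]| <= d].

Definition defective_incidence_colorable (d k : nat) : Prop :=
  exists phi : incidence -> 'I_k, defective_incidence_coloring d phi.

Lemma defective_incidence_colorable_card d :
  defective_incidence_colorable d #|{: incidence}|.
Proof.
have neq u v : adj u v -> u != v.
  by move=> uv; apply: contraTneq uv => ->; rewrite adj_irrefl.
exists enum_rank => u; split=> [v w uv uw vw|v uv|c].
- move=> /enum_rank_inj/(congr1 val)[/setP/(_ v)].
  rewrite !inE eqxx orbT eq_sym (negbTE (neq _ _ uv)) => /esym/eqP.
  exact: vw.
- by move=> /enum_rank_inj/(congr1 val)[/eqP]; rewrite (negbTE (neq _ _ uv)).
- move=> /imsetP[i]; rewrite inE => /existsP[v /andP[_ /eqP iE]] ->.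
  rewrite (_ : [set _ in _ | _] = set0) ?cards0 //.
  apply/setP => j; rewrite !inE; apply/negP => /andP[].
  move=> /existsP[w /andP[uw /eqP jE]] /eqP/enum_rank_inj ji.
  by move: iE (neq _ _ uw); rewrite -ji jE => -[->]; rewrite eqxx.
Qed.

Lemma ex_defective_incidence_colorable d :
  exists k, `[< defective_incidence_colorable d k >].
Proof.
exists #|{: incidence}|; apply/asboolP.
exact: defective_incidence_colorable_card.
Qed.

Definition defective_incidence_chromatic_number (d : nat) : nat :=
  ex_minn (ex_defective_incidence_colorable d).

End Incidences.

Lemma complete_sym n : symmetric (fun x y : 'I_n => x != y).
Proof. by move=> x y; rewrite eq_sym. Qed.

Lemma complete_irrefl n : irreflexive (fun x y : 'I_n => x != y).
Proof. by move=> x; rewrite eqxx. Qed.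

Definition complete_graph (n : nat) : sgraph :=
  SGraph (@complete_sym n) (@complete_irrefl n).

(* Main.v *)
Require Import Defs.
From mathcomp Require Import all_boot.
From mathcomp Require Import boolp zify.

(** Each vertex of [K_n] has [n - 1] strong incidences, of distinct colors.
    For the upper bound, number the vertices by [Z/n] and color the incidence
    [(u, uv)] with [v - u] in [{1, .., n-1}].  All rows and columns are then
    rainbow, and the two incidences of an edge get opposite colors, so the
    only conflicts are on the edges [{u, u + n/2}] for even [n].  Exchanging
    the colors [1] and [n/2] around each vertex [u < n/2] removes them, and
    every color is still seen at most twice among weak incidences, since it
    comes from the difference [c] or from its exchanged value. *)

Set Implicit Arguments.
Unset Strict Implicit.
Unset Printing Implicit Defensive.

Section ArcColorings.
Variable G : sgraph.

Lemma adj_neq (u v : G) : adj u v -> v != u.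
Proof. by apply: contraTneq => ->; rewrite adj_irrefl. Qed.

(** An incidence stores its edge as a set, so the second endpoint has to be searched for; by
    [adj_other_end] the default is never returned. *)
Definition other_end (i : incidence G) : G :=
  odflt (val i).1 [pick v | (v \in (val i).2) && (v != (val i).1)].

Lemma other_endE (i : incidence G) u v :
  adj u v -> val i = (u, [set u; v]) -> other_end i = v.
Proof.
rewrite /other_end => uv -> /=; case: pickP => [w | /(_ v)] /=.
  by rewrite !inE => /andP[/orP[] /eqP -> //]; rewrite eqxx.
by rewrite !inE eqxx orbT adj_neq.
Qed.

Lemma incidence_strong (i : incidence G) :
  exists2 v, adj (val i).1 v & val i = ((val i).1, [set (val i).1; v]).
Proof.
case: i => -[u e] /= /andP[/imsetP[[x y]]]; rewrite inE /= => xy -> /set2P[] ->.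
  by exists y.
by exists x; rewrite ?(adj_sym y) // setUC.
Qed.

Lemma adj_other_end (i : incidence G) : adj (val i).1 (other_end i).
Proof. by have [v uv iE] := incidence_strong i; rewrite (other_endE uv iE). Qed.

(** An incidence $(u, uv)$ amounts to an arc from $u$ to $v$, and the weak incidences of $u$ are the
    arcs entering $u$; this removes edge sets and bounded types from the construction. *)
Lemma arc_coloring_colorable d k (f : G -> G -> nat) :
  (forall u v, adj u v -> f u v < k) ->
  (forall u v w, adj u v -> adj u w -> f u v = f u w -> v = w) ->
  (forall u v, adj u v -> f u v <> f v u) ->
  (forall u c, #|[set v | adj u v & f v u == c]| <= d) ->
  defective_incidence_colorable G d k.
Proof.
move=> f_lt f_inj f_anti f_le.
(* The bound on the color comes from the incidence itself, so [k = 0] is allowed, as $K_1$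
   requires. *)
pose phi i := Ordinal (f_lt _ _ (adj_other_end i)).
have phiE i u v : adj u v -> val i = (u, [set u; v]) -> phi i = f u v :> nat.
  by move=> uv iE; rewrite /= (other_endE uv iE) iE.
have phi_weak i u v : adj u v -> val i = (v, [set u; v]) -> phi i = f v u :> nat.
  by rewrite adj_sym setUC; apply: phiE.
exists phi => u; split=> [v w uv uw vw | v uv | c _].
- move=> /(congr1 (@nat_of_ord k)).
  by rewrite (phiE _ _ _ uv) // (phiE _ _ _ uw) // => /(f_inj _ _ _ uv uw).
- move=> /(congr1 (@nat_of_ord k)).
  by rewrite (phiE _ _ _ uv) // (phi_weak _ _ _ uv) //; apply: f_anti.
- apply: leq_trans (f_le u c).
  (* A weak incidence of [u] is determined by its first vertex, so neighbors can be counted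
     instead. *)
  rewrite -(card_in_imset (f := fun i => (val i).1)) => [|i j].
    apply/subset_leq_card/subsetP=> _ /imsetP[i + ->].
    rewrite !inE => /andP[/existsP[v /andP[uv /eqP iE]] /eqP <-].
    by rewrite (phi_weak _ _ _ uv iE) iE uv eqxx.
  rewrite !inE => /andP[/existsP[v /andP[_ /eqP iE]] _].
  move=> /andP[/existsP[w /andP[_ /eqP jE]] _] vw.
  by apply: val_inj; move: vw; rewrite iE jE /= => ->.
Qed.

Lemma colorable_degree_le d k (u : G) :
  defective_incidence_colorable G d k -> #|[set v | adj u v]| <= k.
Proof.
case=> phi /(_ u)[phi_inj _ _].
pose g (v : {v | adj u v}) := phi (strong_inc (valP v)).
have g_inj : injective g.
  move=> v w gvw; apply: val_inj; apply/eqP/negPn/negP => /eqP vw.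
  exact: phi_inj vw gvw.
have := leq_card g g_inj; rewrite card_ord; apply: leq_trans.
by rewrite card_sig; apply/eq_leq/eq_card => v; rewrite !inE.
Qed.

End ArcColorings.

Section CompleteGraph.
Variable n : nat.

(** For [u] and [v] below [n], the representative of $v - u$ modulo $n$ in $\{1, \dots, n\}$; the
    diagonal gives [n], not 0. *)
Definition cyc_diff (u v : nat) := if u < v then v - u else n + v - u.

Definition exchange (c : nat) :=
  if odd n then c else
  if c == 1 then n./2 else if c == n./2 then 1 else c.

Definition arc_diff (u v : nat) :=
  if u < n./2 then exchange (cyc_diff u v) else cyc_diff u v.

Definition arc_color (u v : nat) := (arc_diff u v).-1.

Hypothesis n_neq2 : n <> 2.

Lemma exchangeK : involutive exchange.
Proof. by move=> c; rewrite /exchange; repeat case: ifP; lia. Qed.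

Lemma cyc_diff_range (u v : 'I_n) : u != v -> 0 < cyc_diff u v < n.
Proof.
rewrite -val_eqE /= /cyc_diff; have := ltn_ord u; have := ltn_ord v.
by case: ifP; lia.
Qed.

Lemma cyc_diff_injr (u v w : 'I_n) : cyc_diff u v = cyc_diff u w -> v = w.
Proof.
move=> E; apply: val_inj; move: E; rewrite /= /cyc_diff.
have := ltn_ord u; have := ltn_ord v; have := ltn_ord w.
by repeat case: ifP; lia.
Qed.

Lemma cyc_diff_injl (u v w : 'I_n) : cyc_diff v u = cyc_diff w u -> v = w.
Proof.
move=> E; apply: val_inj; move: E; rewrite /= /cyc_diff.
have := ltn_ord u; have := ltn_ord v; have := ltn_ord w.
by repeat case: ifP; lia.
Qed.

Lemma exchange_range c : 0 < c < n -> 0 < exchange c < n.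
Proof. by rewrite /exchange; repeat case: ifP; lia. Qed.

Lemma arc_diff_range (u v : 'I_n) : u != v -> 0 < arc_diff u v < n.
Proof.
move=> /cyc_diff_range; rewrite /arc_diff.
by case: ifP => _ // /exchange_range.
Qed.

Lemma arc_diff_inj (u v w : 'I_n) : arc_diff u v = arc_diff u w -> v = w.
Proof.
rewrite /arc_diff; case: ifP => _; last exact: cyc_diff_injr.
by move=> /(inv_inj exchangeK); apply: cyc_diff_injr.
Qed.

(** The two cyclic differences are $c$ and $n - c$, which agree only if $c = n/2$. For even $n$,
    this forces [u] and [v] into different halves, so exactly one side is exchanged. In that mixed
    case a new clash would need $c$ to be 1 or $n/2$ and $n/2 = n - 1$ or $1 = n/2$, hence $n =
    2$. *)
Lemma arc_diff_anti (u v : 'I_n) : u != v -> arc_diff u v <> arc_diff v u.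
Proof.
rewrite -val_eqE /= /arc_diff /exchange /cyc_diff.
have := ltn_ord u; have := ltn_ord v.
by repeat case: ifP; lia.
Qed.

Lemma arc_diff_cyc_diff u v c :
  arc_diff u v = c -> cyc_diff u v = c \/ cyc_diff u v = exchange c.
Proof.
by rewrite /arc_diff; case: ifP => _ <-; [right; rewrite exchangeK | left].
Qed.

Lemma arc_diff_col_le2 (u : 'I_n) c : #|[set v : 'I_n | arc_diff v u == c]| <= 2.
Proof.
pose A b := [set v : 'I_n | cyc_diff v u == b].
have A_le1 b : #|A b| <= 1.
  apply/card_le1_eqP => v w; rewrite !inE => /eqP <- /eqP E.
  exact: cyc_diff_injl E.
apply: (@leq_trans #|A c :|: A (exchange c)|).
  apply/subset_leq_card/subsetP => v; rewrite !inE => /eqP /arc_diff_cyc_diff.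
  by case=> ->; rewrite eqxx ?orbT.
rewrite cardsU; have := A_le1 c; have := A_le1 (exchange c); lia.
Qed.

Lemma complete_graph_colorable d :
  2 <= d -> defective_incidence_colorable (complete_graph n) d (n - 1).
Proof.
move=> d_ge2; pose f (u v : 'I_n) := arc_color u v.
apply: (@arc_coloring_colorable (complete_graph n) d (n - 1) f); rewrite /f.
- by move=> u v /= /arc_diff_range; rewrite /arc_color; lia.
- move=> u v w /= /arc_diff_range uv /arc_diff_range uw E.
  by apply: (@arc_diff_inj u); move: E uv uw; rewrite /arc_color; lia.
- move=> u v /= uv; have := arc_diff_anti uv; have := arc_diff_range uv.
  by move: uv; rewrite eq_sym => /arc_diff_range; rewrite /arc_color; lia.
(* Color [c] stands for the difference [c.+1]: adjacency excludes the diagonal, so differences are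
   positive and the predecessor merges none of them. *)
- move=> u c; apply: leq_trans d_ge2; apply: leq_trans (arc_diff_col_le2 u c.+1).
  apply/subset_leq_card/subsetP => v; rewrite !inE /= eq_sym.
  by move=> /andP[/arc_diff_range]; rewrite /arc_color; lia.
Qed.

End CompleteGraph.

Theorem theorem5 (n d : nat) (n_gt0 : 0 < n) (n_neq2 : n <> 2) (d_ge2 : 2 <= d) :
  defective_incidence_chromatic_number (complete_graph n) d = n - 1.
Proof.
rewrite /defective_incidence_chromatic_number.
case: ex_minnP => k /asboolP k_col k_min; apply/eqP; rewrite eqn_leq.
rewrite k_min /=; last by apply/asboolP/complete_graph_colorable.
(* Vertex 0 exists since $n > 0$, and its degree $n - 1$ is the lower bound. *)
apply: leq_trans (colorable_degree_le (Ordinal n_gt0 : complete_graph n) k_col).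
rewrite (_ : [set v | _] = [set~ (Ordinal n_gt0 : complete_graph n)]).
  by rewrite cardsC1 card_ord subn1.
by apply/setP => v; rewrite !inE /= eq_sym.
Qed.
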